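(* Let $G$ be the Grigorchuk group. Then for every $n\geq 3$ the Andrews-Curtis graph $\Delta_n(G)$ is connected.
   Context: The Grigorchuk group is the group $G=\langle a,b,c,d\rangle$ of automorphisms of the rooted binary tree (bijections of the set of finite words over $\{0,1\}$) generated by $a,b,c,d$, all fixing the empty word and given recursively, for every finite word $w$, by $a(0w)=1w$, $a(1w)=0w$; $b(0w)=0\,a(w)$, $b(1w)=1\,c(w)$; $c(0w)=0\,a(w)$, $c(1w)=1\,d(w)$; $d(0w)=0w$, $d(1w)=1\,b(w)$. For a group $G$, an $n$-tuple is normally generating if the smallest normal subgroup of $G$ containing its entries is $G$. The elementary Andrews-Curtis moves (AC-moves) on $G^n$ are: replacing $x_i$ by $x_i x_j^{\pm1}$ or by $x_j^{\pm1}x_i$ for some $j\neq i$; replacing $x_j$ by $x_j^{-1}$; replacing $x_i$ by a conjugate $x_i^s$ with $s\in G$; in each case the other entries are unchanged. The Andrews-Curtis graph $\Delta_n(G)$ has as vertices the normally generating $n$-tuples of $G$, two vertices being joined by an edge if one is obtained from the other by an AC-move. *)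

(* Defs.v *)
From HB Require Import structures.
From mathcomp Require Import all_boot all_fingroup.
From mathcomp Require Import boolp classical_sets.

Set Implicit Arguments.
Unset Strict Implicit.
Unset Printing Implicit Defensive.

Local Open Scope group_scope.
Local Open Scope classical_set_scope.

Definition is_subgroup (G : groupType) (H : set G) : Prop :=
  [/\ H 1, (forall x y, H x -> H y -> H (x * y)) & (forall x, H x -> H x^-1)].

Definition is_normal_subgroup (G : groupType) (N : set G) : Prop :=
  is_subgroup N /\ (forall x s, N x -> N (x ^ s)).

Definition generated_subgroup (G : groupType) (A : set G) : set G :=
  smallest (@is_subgroup G) A.

Definition normal_closure (G : groupType) (A : set G) : set G :=
  smallest (@is_normal_subgroup G) A.

Lemma generated_subgroup_subgroup (G : groupType) (A : set G) :
  is_subgroup (generated_subgroup A).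
Proof.
split=> [H [[]]//|x y Hx Hy H HA|x Hx H HA].
- by case: (HA) => -[_ HM _] _; apply: HM; [exact: Hx | exact: Hy].
- by case: (HA) => -[_ _ HV] _; apply: HV; exact: Hx.
Qed.

Lemma generated_subgroup_closed (G : groupType) (A : set G) :
  group_closed [in generated_subgroup A].
Proof.
have [H1 HM HV] := generated_subgroup_subgroup A.
split=> [|x y]; rewrite !inE; first exact: H1.
by move=> Hx Hy; apply: HM => //; apply: HV.
Qed.

Section AndrewsCurtis.
Variables (G : groupType) (n : nat).
Implicit Types x y : {ffun 'I_n -> G}.

Definition normally_generating x : Prop :=
  normal_closure [set x i | i in [set: 'I_n]] = [set: G].

Definition replace_entry x (i : 'I_n) (g : G) : {ffun 'I_n -> G} :=
  [ffun k => if k == i then g else x k].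

Inductive ac_move x : {ffun 'I_n -> G} -> Prop :=
| ACmulr (i j : 'I_n) of j != i : ac_move x (replace_entry x i (x i * x j))
| ACdivr (i j : 'I_n) of j != i : ac_move x (replace_entry x i (x i * (x j)^-1))
| ACmull (i j : 'I_n) of j != i : ac_move x (replace_entry x i (x j * x i))
| ACdivl (i j : 'I_n) of j != i : ac_move x (replace_entry x i ((x j)^-1 * x i))
| ACinv (j : 'I_n) : ac_move x (replace_entry x j (x j)^-1)
| ACconj (i : 'I_n) (s : G) : ac_move x (replace_entry x i (x i ^ s)).

Definition ac_vertex : Type :=
  {x : {ffun 'I_n -> G} | `[< normally_generating x >]}.

Definition ac_edge : rel ac_vertex :=
  fun u v => `[< ac_move (val u) (val v) \/ ac_move (val v) (val u) >].

End AndrewsCurtis.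

Definition connected_graph (V : Type) (e : rel V) : Prop :=
  inhabited V /\ forall u v : V, exists p : seq V, path e u p /\ last u p = v.

(* Order automorphisms of the words under the prefix order are exactly the
   automorphisms of the rooted binary tree. *)
Record tree_aut : Type := TreeAut {
  aut_fun :> seq bool -> seq bool;
  aut_inv : seq bool -> seq bool;
  aut_funK : cancel aut_fun aut_inv;
  aut_invK : cancel aut_inv aut_fun;
  aut_prefix : forall u w, prefix (aut_fun u) (aut_fun w) = prefix u w
}.

HB.instance Definition _ := gen_eqMixin tree_aut.
HB.instance Definition _ := gen_choiceMixin tree_aut.

Lemma tree_aut_ext (f g : tree_aut) : f =1 g -> f = g.
Proof.
case: f g => [f f' fK f'K fp] [g g' gK g'K gp] /= /funext fg.
have fg' : f' = g' by apply: funext => w; rewrite -{1}(g'K w) -fg fK.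
by subst g g'; congr TreeAut; exact: Prop_irrelevance.
Qed.

Definition aut_one : tree_aut :=
  @TreeAut id id (fun=> erefl) (fun=> erefl) (fun _ _ => erefl).

Lemma aut_inv_prefix (f : tree_aut) u w :
  prefix (aut_inv f u) (aut_inv f w) = prefix u w.
Proof. by rewrite -(aut_prefix f) !aut_invK. Qed.

Definition aut_opp (f : tree_aut) : tree_aut :=
  TreeAut (aut_invK f) (aut_funK f) (aut_inv_prefix f).

Lemma aut_comp_prefix (f g : tree_aut) u w :
  prefix ((f \o g) u) ((f \o g) w) = prefix u w.
Proof. by rewrite /= !aut_prefix. Qed.

Definition aut_comp (f g : tree_aut) : tree_aut :=
  TreeAut (can_comp (aut_funK f) (aut_funK g))
          (can_comp (aut_invK g) (aut_invK f))
          (aut_comp_prefix f g).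

Lemma aut_compA : associative aut_comp.
Proof. by move=> f g h; apply: tree_aut_ext. Qed.
Lemma aut_comp1f : left_id aut_one aut_comp.
Proof. by move=> f; apply: tree_aut_ext. Qed.
Lemma aut_compf1 : right_id aut_one aut_comp.
Proof. by move=> f; apply: tree_aut_ext. Qed.
Lemma aut_compVf : left_inverse aut_one aut_opp aut_comp.
Proof. by move=> f; apply: tree_aut_ext => w /=; rewrite aut_funK. Qed.
Lemma aut_compfV : right_inverse aut_one aut_opp aut_comp.
Proof. by move=> f; apply: tree_aut_ext => w /=; rewrite aut_invK. Qed.

HB.instance Definition _ := isGroup.Build tree_aut
  aut_compA aut_comp1f aut_compf1 aut_compVf aut_compfV.

(* The letters 0 and 1 are encoded by false and true. *)
Definition fun_a (w : seq bool) : seq bool :=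
  match w with
  | [::] => [::]
  | false :: v => true :: v
  | true :: v => false :: v
  end.

Fixpoint fun_b (w : seq bool) : seq bool :=
  match w with
  | [::] => [::]
  | false :: v => false :: fun_a v
  | true :: v => true :: fun_c v
  end
with fun_c (w : seq bool) : seq bool :=
  match w with
  | [::] => [::]
  | false :: v => false :: fun_a v
  | true :: v => true :: fun_d v
  end
with fun_d (w : seq bool) : seq bool :=
  match w with
  | [::] => [::]
  | false :: v => false :: v
  | true :: v => true :: fun_b v
  end.

Lemma fun_aK : involutive fun_a.
Proof. by case=> [|[] v]. Qed.

Lemma fun_bcdK w :
  [/\ fun_b (fun_b w) = w, fun_c (fun_c w) = w & fun_d (fun_d w) = w].
Proof. by elim: w => [|[] v [bK cK dK]] //=; rewrite ?bK ?cK ?dK ?fun_aK. Qed.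

Lemma fun_bK : involutive fun_b. Proof. by move=> w; case: (fun_bcdK w). Qed.
Lemma fun_cK : involutive fun_c. Proof. by move=> w; case: (fun_bcdK w). Qed.
Lemma fun_dK : involutive fun_d. Proof. by move=> w; case: (fun_bcdK w). Qed.

Lemma fun_a_prefix u w : prefix (fun_a u) (fun_a w) = prefix u w.
Proof. by case: u w => [|[] u] [|[] w]. Qed.

Lemma fun_bcd_prefix u w :
  [/\ prefix (fun_b u) (fun_b w) = prefix u w,
      prefix (fun_c u) (fun_c w) = prefix u w
    & prefix (fun_d u) (fun_d w) = prefix u w].
Proof.
elim: u w => [|x u IH] w; first by split; rewrite !prefix0s.
case: w => [|y w]; first by case: x.
have [bp cp dp] := IH w.
by case: x; case: y; split; rewrite /= ?eqxx ?bp ?cp ?dp ?fun_a_prefix.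
Qed.

Lemma fun_b_prefix u w : prefix (fun_b u) (fun_b w) = prefix u w.
Proof. by case: (fun_bcd_prefix u w). Qed.
Lemma fun_c_prefix u w : prefix (fun_c u) (fun_c w) = prefix u w.
Proof. by case: (fun_bcd_prefix u w). Qed.
Lemma fun_d_prefix u w : prefix (fun_d u) (fun_d w) = prefix u w.
Proof. by case: (fun_bcd_prefix u w). Qed.

Definition aut_a : tree_aut := TreeAut fun_aK fun_aK fun_a_prefix.
Definition aut_b : tree_aut := TreeAut fun_bK fun_bK fun_b_prefix.
Definition aut_c : tree_aut := TreeAut fun_cK fun_cK fun_c_prefix.
Definition aut_d : tree_aut := TreeAut fun_dK fun_dK fun_d_prefix.

Definition grigorchuk_set : set tree_aut :=
  generated_subgroup [set aut_a; aut_b; aut_c; aut_d].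

Definition grigorchuk : Type := {g : tree_aut | g \in grigorchuk_set}.

HB.instance Definition _ := SubChoice.on grigorchuk.
HB.instance Definition _ := SubChoice_isSubGroup.Build
  tree_aut [in grigorchuk_set] grigorchuk (@generated_subgroup_closed _ _).

(* Main.v *)
Require Import Defs.
From mathcomp Require Import all_boot.
From mathcomp Require Import boolp classical_sets.

(* Let [N] be normal in the Grigorchuk group [G] and such that [G / N] is
   normally generated by one element. If [G / N] is nilpotent, then it is
   abelian: when commutators are central, the centralizer of a normal generator
   contains them, hence is normal, hence is everything. And [G / N] is nilpotent
   as soon as some [h] in [N] swaps the two subtrees of the root. Indeed
   let [B] be the normal closure of [b]; [1 x B] lies in
   [G], and [L = {f in B | (1, f) in N}] is normal in [G]. Taking commutators of
   [h] with [1 x B] and with [b = (a, c)] shows that [B' <= L] and that [ca]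
   centralizes [B] modulo [L], so that [B] is in the second center modulo [L]
   and [D = B x B] in the fourth center modulo [N]; finally [G / D] is
   a dihedral 2-group.

   AC-moves multiply the entry [x_i] by any element of the normal closure [N_i]
   of the other entries. Nielsen moves first bring the tuple to
   [(a, ac, ad, 1, ..., 1)] in [G / G' = (Z/2)^3]; every [N_i] then contains an
   element swapping the two subtrees, so [G' <= N_i] and the entries can be
   corrected one after the other. *)

Set Implicit Arguments.
Unset Strict Implicit.
Unset Printing Implicit Defensive.

Local Open Scope group_scope.
Local Open Scope classical_set_scope.

(** * Normal subgroups and upper central series modulo them *)

Section NormalSubgroups.
Variable G : groupType.
Implicit Types (S T A : set G) (x y z : G).

Section Closure.
Variables (S : set G) (nS : is_normal_subgroup S).

Lemma nsub1 : S 1. Proof. by case: nS => -[]. Qed.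
Lemma nsubM x y : S x -> S y -> S (x * y).
Proof. by case: nS => -[_ + _] _; apply. Qed.
Lemma nsubV x : S x -> S x^-1. Proof. by case: nS => -[_ _ +] _; apply. Qed.
Lemma nsubJ x y : S x -> S (x ^ y). Proof. by case: nS => _; apply. Qed.

Lemma nsubMl x y : S x -> S (x * y) <-> S y.
Proof.
move=> Sx; split=> [Sxy|]; last exact: nsubM.
by rewrite -(mulKg x y); apply: nsubM => //; apply: nsubV.
Qed.

Lemma nsubMr x y : S y -> S (x * y) <-> S x.
Proof.
move=> Sy; split=> [Sxy|Sx]; last exact: nsubM.
by rewrite -(mulgK y x); apply: nsubM => //; apply: nsubV.
Qed.

Lemma nsub_commC x y : S [~ x, y] -> S [~ y, x].
Proof. by rewrite -invgR => /nsubV; rewrite invgK. Qed.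

Lemma nsub_comml x y : S x -> S [~ x, y].
Proof. by move=> Sx; apply: nsubM; [apply: nsubV|apply: nsubJ]. Qed.

Lemma nsub_commr x y : S y -> S [~ x, y].
Proof. by move=> Sy; apply/nsub_commC/nsub_comml. Qed.

Lemma nsub_commMr x y z : S [~ x, y] -> S [~ x, z] -> S [~ x, y * z].
Proof.
move=> Sy Sz; have -> : [~ x, y * z] = [~ x, z] * [~ x, y] ^ z.
  by rewrite /commg /conjg !gnorm.
by apply: nsubM => //; apply: nsubJ.
Qed.

Lemma nsub_commVr x y : S [~ x, y] -> S [~ x, y^-1].
Proof.
move=> Sy; have -> : [~ x, y^-1] = ([~ x, y]^-1) ^ y^-1.
  by rewrite /commg /conjg !gnorm.
by apply: nsubJ; apply: nsubV.
Qed.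

Lemma nsub_commMl x y z : S [~ x, z] -> S [~ y, z] -> S [~ x * y, z].
Proof.
by move=> /nsub_commC Sx /nsub_commC Sy; apply/nsub_commC/nsub_commMr.
Qed.

Lemma nsub_commVl x y : S [~ x, y] -> S [~ x^-1, y].
Proof. by move=> /nsub_commC Sx; apply/nsub_commC/nsub_commVr. Qed.

Lemma centralizer_subgroup x : is_subgroup [set y | S [~ x, y]].
Proof.
split=> /= [|y z|y]; [rewrite commg1; exact: nsub1| |].
- exact: nsub_commMr.
- exact: nsub_commVr.
Qed.

End Closure.

Lemma subgroup_normal (H : set G) :
  is_subgroup H -> (forall x y, H [~ x, y]) -> is_normal_subgroup H.
Proof.
move=> sH Hc; split=> // x y Hx.
have -> : x ^ y = x * [~ x, y] by rewrite /commg mulVKg.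
by case: sH => _ + _; apply.
Qed.

Lemma normal_closure_normal A : is_normal_subgroup (normal_closure A).
Proof.
split; first split.
- by move=> H [/nsub1].
- move=> x y Hx Hy H HA; have [nH _] := HA.
  by apply: nsubM => //; [apply: Hx|apply: Hy].
- by move=> x Hx H HA; have [nH _] := HA; apply: nsubV => //; apply: Hx.
- by move=> x y Hx H HA; have [nH _] := HA; apply: nsubJ => //; apply: Hx.
Qed.

(** The preimage of the center of [G / S]; its iterates form the upper central series modulo [S],
    and nilpotency of [G / S] means that some iterate is [setT]. *)
Definition center_mod S : set G := [set x | forall y, S [~ x, y]].

Lemma center_mod_normal S :
  is_normal_subgroup S -> is_normal_subgroup (center_mod S).
Proof.
move=> nS; split; first split=> [y|x y Sx Sy z|x Sx y].
- by rewrite comm1g; apply: nsub1.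
- by apply: nsub_commMl.
- by apply: nsub_commVl.
- move=> x s Sx y /=; rewrite -(conjgKV s y) -conjRg.
  exact: nsubJ.
Qed.

Lemma sub_center_mod S : is_normal_subgroup S -> S `<=` center_mod S.
Proof. by move=> nS x Sx y; apply: nsub_comml. Qed.

Lemma iter_center_mod_normal S k :
  is_normal_subgroup S -> is_normal_subgroup (iter k center_mod S).
Proof. by move=> nS; elim: k => // k; apply: center_mod_normal. Qed.

Lemma sub_iter_center_mod S k :
  is_normal_subgroup S -> S `<=` iter k center_mod S.
Proof.
move=> nS; elim: k => // k IH x /IH; apply: sub_center_mod.
exact: iter_center_mod_normal.
Qed.

Lemma cyclic_mod_center S x : is_normal_subgroup S ->
    (forall P, is_normal_subgroup P -> S `<=` P -> P x -> P = setT) ->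
  center_mod (center_mod S) = setT -> center_mod S = setT.
Proof.
move=> nS gen ZZ.
have ZC y z : center_mod S [~ y, z].
  have : center_mod (center_mod S) y by rewrite ZZ.
  exact.
have Cx : [set y | S [~ x, y]] = setT.
  apply: gen => [|y Sy|] /=.
  - apply: subgroup_normal; first exact: centralizer_subgroup.
    by move=> y z /=; apply: nsub_commC => //; apply: ZC.
  - exact: nsub_commr.
  - by rewrite commgg; apply: nsub1.
apply: gen; [exact: center_mod_normal|exact: sub_center_mod|].
by move=> y; have : [set: G] y by []; rewrite -Cx.
Qed.

(** Lowers the class by one at a time: the class 2 case applies with the [k]-th center modulo [S] in
    place of [S], as [x] still generates modulo this larger subgroup. *)
Lemma cyclic_mod_iter_center S x k : is_normal_subgroup S ->
    (forall P, is_normal_subgroup P -> S `<=` P -> P x -> P = setT) ->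
  iter k.+1 center_mod S = setT -> center_mod S = setT.
Proof.
move=> nS gen; elim: k => [//|k IH] ZZ.
apply: IH => /=; apply: (@cyclic_mod_center _ x) => //.
  exact: iter_center_mod_normal.
by move=> P nP SP; apply: gen => // y Sy; apply/SP/sub_iter_center_mod.
Qed.

End NormalSubgroups.

Arguments center_mod {G} S.

Local Notation Grig := grigorchuk.

(** * Generators and relations of the Grigorchuk group *)

Section Grigorchuk.
Implicit Types (f g h x y z : Grig) (S N : set Grig).

Lemma grigorchuk_set_gen t :
  [set aut_a; aut_b; aut_c; aut_d] t -> t \in grigorchuk_set.
Proof. by move=> Ht; apply/mem_set; apply: sub_gen_smallest. Qed.

Definition ga : Grig := exist _ aut_a
  (grigorchuk_set_gen (or_introl (or_introl (or_introl erefl)))).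
Definition gb : Grig := exist _ aut_b
  (grigorchuk_set_gen (or_introl (or_introl (or_intror erefl)))).
Definition gc : Grig := exist _ aut_c
  (grigorchuk_set_gen (or_introl (or_intror erefl))).
Definition gd : Grig := exist _ aut_d (grigorchuk_set_gen (or_intror erefl)).

Lemma grigM g h w : val (g * h) w = val g (val h w). Proof. by []. Qed.
Lemma grigV g w : val g^-1 w = aut_inv (val g) w. Proof. by []. Qed.

Lemma grig_ext g h : val g =1 val h -> g = h.
Proof. by move=> gh; apply/val_inj/tree_aut_ext. Qed.

Lemma grig_ind_gen (H : set Grig) :
  is_subgroup H -> H ga -> H gb -> H gc -> H gd -> H = setT.
Proof.
move=> [H1 HM HV] Ha Hb Hc Hd; apply/seteqP; split=> // -[t pt] _.
(* The image of [H] in [tree_aut] is a subgroup containing the four generators, so it contains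
   [grigorchuk_set]. *)
pose K : set tree_aut := [set u | exists2 g : Grig, val g = u & H g].
suff [g gt Hg] : K t by rewrite (_ : exist _ _ _ = g) //; apply: val_inj.
apply: (set_mem pt) => /=; split; first split.
- by exists 1.
- by move=> _ _ [x <- Hx] [y <- Hy]; exists (x * y) => //; apply: HM.
- by move=> _ [x <- Hx]; exists x^-1 => //; apply: HV.
- by move=> u [[[]|]|] ->; [exists ga|exists gb|exists gc|exists gd].
Qed.

Lemma gaa : ga * ga = 1. Proof. by apply: grig_ext => w; apply: fun_aK. Qed.
Lemma gbb : gb * gb = 1. Proof. by apply: grig_ext => w; apply: fun_bK. Qed.
Lemma gcc : gc * gc = 1. Proof. by apply: grig_ext => w; apply: fun_cK. Qed.
Lemma gdd : gd * gd = 1. Proof. by apply: grig_ext => w; apply: fun_dK. Qed.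
Lemma gaV : ga^-1 = ga. Proof. by apply: mulg1_eq; apply: gaa. Qed.
Lemma gbV : gb^-1 = gb. Proof. by apply: mulg1_eq; apply: gbb. Qed.
Lemma gcV : gc^-1 = gc. Proof. by apply: mulg1_eq; apply: gcc. Qed.
Lemma gdV : gd^-1 = gd. Proof. by apply: mulg1_eq; apply: gdd. Qed.

Lemma fun_bcd w : [/\ fun_b (fun_c w) = fun_d w, fun_c (fun_d w) = fun_b w
  & fun_d (fun_b w) = fun_c w].
Proof. by elim: w => [|[] v [bc cd db]] //=; rewrite ?bc ?cd ?db ?fun_aK. Qed.

Lemma gbc : gb * gc = gd.
Proof. by apply: grig_ext => w; case: (fun_bcd w). Qed.
Lemma gcd : gc * gd = gb.
Proof. by apply: grig_ext => w; case: (fun_bcd w). Qed.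
Lemma gdb : gd * gb = gc.
Proof. by apply: grig_ext => w; case: (fun_bcd w). Qed.
Lemma gdc : gd * gc = gb.
Proof. by apply: invg_inj; rewrite invgM gcV gdV gcd gbV. Qed.
Lemma gbd : gb * gd = gc.
Proof. by apply: invg_inj; rewrite invgM gdV gbV gdb gcV. Qed.

(** * Sections on the two subtrees of the root: [g = (g0, g1)] *)

Definition level1 g g0 g1 : Prop := forall w,
  val g (false :: w) = false :: val g0 w /\ val g (true :: w) = true :: val g1 w.

Lemma grig_nil g : val g [::] = [::].
Proof.
have := aut_prefix (val g) [::] (aut_inv (val g) [::]).
by rewrite aut_invK prefix0s; case: (val g [::]).
Qed.

Lemma level1_inj g h x y : level1 g x y -> level1 h x y -> g = h.
Proof.
move=> gxy hxy; apply: grig_ext => -[|[] w]; first by rewrite !grig_nil.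
  by rewrite (gxy w).2 (hxy w).2.
by rewrite (gxy w).1 (hxy w).1.
Qed.

Lemma level1_1 : level1 1 1 1. Proof. by []. Qed.

Lemma level1M g h g0 g1 h0 h1 :
  level1 g g0 g1 -> level1 h h0 h1 -> level1 (g * h) (g0 * h0) (g1 * h1).
Proof.
by move=> lg lh w; rewrite !grigM (lh w).1 (lh w).2 (lg _).1 (lg _).2.
Qed.

Lemma level1V g g0 g1 : level1 g g0 g1 -> level1 g^-1 g0^-1 g1^-1.
Proof.
move=> lg w; rewrite !grigV; split; apply: (can_inj (aut_funK (val g)));
  rewrite aut_invK.
  by rewrite (lg _).1 aut_invK.
by rewrite (lg _).2 aut_invK.
Qed.

Lemma level1J g h g0 g1 h0 h1 :
  level1 g g0 g1 -> level1 h h0 h1 -> level1 (g ^ h) (g0 ^ h0) (g1 ^ h1).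
Proof.
by move=> lg lh; rewrite /conjg; do !apply: level1M => //; apply: level1V.
Qed.

Lemma level1R g h g0 g1 h0 h1 :
  level1 g g0 g1 -> level1 h h0 h1 -> level1 [~ g, h] [~ g0, h0] [~ g1, h1].
Proof. by move=> lg lh; apply: level1M; [apply: level1V|apply: level1J]. Qed.

Lemma level1Ja g g0 g1 : level1 g g0 g1 -> level1 (g ^ ga) g1 g0.
Proof. by move=> lg w; rewrite /conjg gaV !grigM /= (lg w).1 (lg w).2. Qed.

Lemma level1_b : level1 gb ga gc. Proof. by []. Qed.
Lemma level1_d : level1 gd 1 gb. Proof. by []. Qed.

Lemma level1_dec g : exists g0 g1, level1 g g0 g1 \/ level1 (g * ga) g0 g1.
Proof.
pose H : set Grig :=
  [set g | exists g0 g1, level1 g g0 g1 \/ level1 (g * ga) g0 g1].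
have : [set: Grig] g by []; rewrite -(@grig_ind_gen H) //=.
- split=> /=; first by exists 1, 1; left.
  + move=> x y [x0 [x1 lx]] [y0 [y1 ly]]; case: lx => lx; case: ly => ly.
    * by exists (x0 * y0), (x1 * y1); left; apply: level1M.
    * by exists (x0 * y0), (x1 * y1); right; rewrite -mulgA; apply: level1M.
    * exists (x0 * y1), (x1 * y0); right.
      rewrite -mulgA [y * ga](_ : _ = ga * y ^ ga); last first.
        by rewrite /conjg gaV !mulgA gaa mul1g.
      by rewrite mulgA; apply: level1M => //; apply: level1Ja.
    * exists (x0 * y1), (x1 * y0); left.
      rewrite (_ : x * y = x * ga * (y * ga) ^ ga).
        by apply: level1M => //; apply: level1Ja.
      by rewrite /conjg gaV -!mulgA gaa mulg1 (mulgA ga ga) gaa mul1g.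
  + move=> x [x0 [x1 []]] lx; first by exists x0^-1, x1^-1; left; apply: level1V.
    exists x1^-1, x0^-1; right; move/level1V/level1Ja: lx.
    by rewrite invgM gaV /conjg gaV !mulgA gaa mul1g.
- by exists 1, 1; right; rewrite gaa.
- by exists ga, gc; left.
- by exists ga, gd; left.
- by exists 1, gb; left.
Qed.

(** The stabilizer of the first level projects onto the group: [a], [b], [c], [d] are the right
    sections of [b ^ a = (c, a)], [d = (1, b)], [b = (a, c)], [c = (a, d)]. *)
Lemma level1_surj g1 : exists g g0, level1 g g0 g1.
Proof.
pose H : set Grig := [set g1 | exists g g0, level1 g g0 g1].
have : [set: Grig] g1 by []; rewrite -(@grig_ind_gen H) //=.
- split=> /=; first by exists 1, 1.
  + move=> x y [x1 [x0 lx]] [y1 [y0 ly]].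
    by exists (x1 * y1), (x0 * y0); apply: level1M.
  + by move=> x [x1 [x0 lx]]; exists x1^-1, x0^-1; apply: level1V.
- by exists (gb ^ ga), gc; apply: level1Ja.
- by exists gd, 1.
- by exists gb, ga.
- by exists gc, ga.
Qed.

(** * The normal closure [B] of [b] and the subgroup [1 x B] *)

Definition b_closure : set Grig := normal_closure [set gb].

Lemma normal_b_closure : is_normal_subgroup b_closure.
Proof. exact: normal_closure_normal. Qed.

Lemma b_closure_b : b_closure gb. Proof. exact: sub_gen_smallest. Qed.

Lemma b_closure_sub S : is_normal_subgroup S -> S gb -> b_closure `<=` S.
Proof. by move=> nS Sb; apply: smallest_sub => // _ ->. Qed.

(** [d = (1, b)] lifts [b], and conjugating a lift [(1, f)] by an element with right section [s]
    lifts [f ^ s]. *)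
Lemma b_closure_lift f : b_closure f -> exists p, level1 p 1 f.
Proof.
apply: (@b_closure_sub [set f | exists p, level1 p 1 f]) f; last by exists gd.
split; first split=> /=; first by exists 1.
- by move=> x y [p lp] [q lq]; exists (p * q); rewrite -(mulg1 1); apply: level1M.
- by move=> x [p lp]; exists p^-1; rewrite -invg1; apply: level1V.
- move=> x s [p lp]; have [g [g0 lg]] := level1_surj s.
  by exists (p ^ g); rewrite -(conj1g g0); apply: level1J.
Qed.

(** For [S = N] this is the subgroup [L] of the opening comment. *)
Definition rist S : set Grig :=
  [set f | b_closure f /\ exists2 p, S p & level1 p 1 f].

Lemma rist_normal S : is_normal_subgroup S -> is_normal_subgroup (rist S).
Proof.
move=> nS; have nB := normal_b_closure; split; first split=> /=.
- by split; [exact: nsub1 nB|exists 1 => //; exact: nsub1 nS].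
- move=> x y [Bx [p Sp lp]] [By [q Sq lq]]; split; first exact: (nsubM nB).
  by exists (p * q); [apply: (nsubM nS)|rewrite -(mulg1 1); apply: level1M].
- move=> x [Bx [p Sp lp]]; split; first exact: (nsubV nB).
  by exists p^-1; [apply: (nsubV nS)|rewrite -invg1; apply: level1V].
- move=> x s [Bx [p Sp lp]]; split; first exact: (nsubJ nB).
  have [g [g0 lg]] := level1_surj s.
  by exists (p ^ g); [apply: (nsubJ nS)|rewrite -(conj1g g0); apply: level1J].
Qed.

Lemma ristP S p f : b_closure f -> level1 p 1 f -> rist S f -> S p.
Proof. by move=> Bf lp [_ [q Sq lq]]; rewrite (level1_inj lp lq). Qed.

Lemma rist_sub S T : S `<=` T -> rist S `<=` rist T.
Proof. by move=> ST f [Bf [p Sp lp]]; split=> //; exists p => //; apply: ST. Qed.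

Lemma center_mod_level1 S x : is_normal_subgroup S -> S [~ x, ga] ->
    (forall g g0 g1, level1 g g0 g1 -> S [~ x, g]) -> center_mod S x.
Proof.
move=> nS Sa S1 g; have [g0 [g1 [lg|lg]]] := level1_dec g; first exact: S1 lg.
have -> : g = g * ga * ga by rewrite -mulgA gaa mulg1.
by apply: nsub_commMr => //; apply: S1 lg.
Qed.

(** Modulo [S], the element [p = (1, f)] commutes with the first level stabilizer, since [[p, g] =
    (1, [f, g1])]. So does [p ^ a], hence also [[p, a] = (f, f^-1)]; and [[[p, a], a] = (f^-2, f^2)]
    is in [S] by the assumption on [f^2]. Thus [[p, a]] is central modulo [S]. *)
Lemma rist_center_mod S f : is_normal_subgroup S -> b_closure f ->
  rist S (f * f) -> center_mod (rist S) f -> rist (center_mod (center_mod S)) f.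
Proof.
move=> nS Bf Sff Zf; have nZ := center_mod_normal nS.
have [p lp] := b_closure_lift Bf; split=> //; exists p => //.
have Spp : S (p * p).
  apply: ristP Sff; first exact: (nsubM normal_b_closure Bf Bf).
  by rewrite -(mulg1 1); apply: level1M.
have Sp g g0 g1 : level1 g g0 g1 -> S [~ p, g].
  move=> lg; apply: (@ristP _ _ [~ f, g1]); last exact: Zf.
    exact: (nsub_comml normal_b_closure).
  by rewrite -(comm1g g0); apply: level1R.
apply: center_mod_level1 => //; last first.
  by move=> g g0 g1 lg; apply: sub_center_mod => //; apply: Sp lg.
have lu : level1 [~ p, ga] f f^-1.
  have := level1M (level1V lp) (level1Ja lp).
  by rewrite invg1 mul1g mulg1.
apply: center_mod_level1 => //.
- have -> : [~ [~ p, ga], ga] = ((p * p) ^ ga)^-1 * (p * p).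
    apply: level1_inj (level1M (level1V lu) (level1Ja lu)) _.
    have lpp := level1M lp lp.
    have := level1M (level1V (level1Ja lpp)) lpp.
    by rewrite !invgM !invgK invg1 !mulg1 !mul1g.
  by apply: nsubM => //; apply: nsubV => //; apply: nsubJ.
- move=> g g0 g1 lg; rewrite /commg /= -/(commg _ _).
  apply: nsub_commMl => //; first by apply: nsub_commVl => //; apply: Sp lg.
  have -> : [~ p ^ ga, g] = [~ p, g ^ ga] ^ ga.
    by rewrite conjRg -conjgM gaa conjg1.
  by apply: nsubJ => //; apply: Sp (level1Ja lg).
Qed.


(** * Dihedral quotients *)

Lemma center_mod_gen S x : is_normal_subgroup S ->
  S [~ x, ga] -> S [~ x, gb] -> S [~ x, gc] -> center_mod S x.
Proof.
move=> nS Sa Sb Sc y.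
suff : [set y | S [~ x, y]] y by [].
rewrite (@grig_ind_gen [set y | S [~ x, y]]) //=; first exact: centralizer_subgroup.
by rewrite -gbc; apply: nsub_commMr.
Qed.

Lemma nsub_gen S : is_normal_subgroup S -> S ga -> S gb -> S gc -> S = setT.
Proof.
move=> nS Sa Sb Sc; apply: grig_ind_gen => //; first by case: nS.
by rewrite -gbc; apply: (nsubM nS).
Qed.

Lemma level1_ad2 : level1 (ga * gd * (ga * gd)) gb gb.
Proof.
have := level1M (level1Ja level1_d) level1_d.
by rewrite /conjg gaV mulg1 mul1g !mulgA.
Qed.

Lemma gad4 : (ga * gd * (ga * gd)) * (ga * gd * (ga * gd)) = 1.
Proof.
apply: level1_inj level1_1; rewrite -{1}gbb -gbb.
exact: level1M level1_ad2 level1_ad2.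
Qed.

(* The quotient by the normal closure of b is dihedral of order 8. *)
Lemma b_closure_class2 S : is_normal_subgroup S -> S gb ->
  center_mod (center_mod S) = setT.
Proof.
(* [z = [a, d]] is inverted by [a] and by [d], hence fixed by both as [z^2 = 1]; since [b] is in
   [S], it is central modulo [S]. *)
move=> nS Sb; pose z := ga * gd * (ga * gd).
have nZ := center_mod_normal nS; have nZZ := center_mod_normal nZ.
have zV : z^-1 = z by apply: mulg1_eq; apply: gad4.
have za : z ^ ga = z.
  by rewrite -[RHS]zV /conjg /z !invgM gaV gdV !mulgA gaa mul1g.
have zd : z ^ gd = z.
  by rewrite -[RHS]zV /conjg /z !invgM gaV gdV -!mulgA gdd mulg1.
have Zz : center_mod S z.
  have Szd : S [~ z, gd] by rewrite /commg zd mulVg; apply: (nsub1 nS).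
  have Szb : S [~ z, gb] by apply: nsub_commr.
  apply: (center_mod_gen nS) => //.
    by rewrite /commg za mulVg; apply: (nsub1 nS).
  by rewrite -gbd; apply: nsub_commMr.
have adz : [~ ga, gd] = z by rewrite /commg /conjg gaV gdV /z !mulgA.
have Zb : center_mod S gb by apply: sub_center_mod.
have ZZb : center_mod (center_mod S) gb by exact: (sub_center_mod nZ).
have c_bd x : center_mod S [~ x, gd] -> center_mod S [~ x, gc].
  by move=> Zx; rewrite -gbd; apply: (nsub_commMr nZ) => //; apply: (nsub_commr nZ).
apply: nsub_gen => //.
- apply: (center_mod_gen nZ) => //; first by rewrite commgg; apply: (nsub1 nZ).
    exact: (nsub_commr nZ).
  by apply: c_bd; rewrite adz.
- rewrite -gbd; apply: (nsubM nZZ) => //.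
  apply: (center_mod_gen nZ) => //; first by apply: (nsub_commC nZ); rewrite adz.
    exact: (nsub_commr nZ).
  by apply: c_bd; rewrite commgg; apply: (nsub1 nZ).
Qed.

(** Both [a] and [b] invert [r = (ab)^m], so its commutators with them are [r^-2]; modulo [d], the
    generator [c] equals [b]. *)
Lemma center_mod_ab S m : is_normal_subgroup S -> S gd ->
  S ((ga * gb) ^+ (m + m)) -> center_mod S ((ga * gb) ^+ m).
Proof.
move=> nS Sd; rewrite expgnDr => Sm; set r := _ ^+ m in Sm *.
have ra : r ^ ga = r^-1.
  by rewrite /r conjXg -expVgn invgM gaV gbV /conjg gaV !mulgA gaa mul1g.
have rb : r ^ gb = r^-1.
  by rewrite /r conjXg -expVgn invgM gaV gbV /conjg gbV -!mulgA gbb mulg1.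
have Sa : S [~ r, ga] by rewrite /commg ra -invgM; exact: (nsubV nS Sm).
have Sb : S [~ r, gb] by rewrite /commg rb -invgM; exact: (nsubV nS Sm).
apply: center_mod_gen => //.
by rewrite -gbd; apply: nsub_commMr => //; apply: nsub_commr.
Qed.

(* Modulo the normal closure of d and (ab)^8, the group is dihedral of
   order 16. *)
Lemma dihedral_class3 S : is_normal_subgroup S -> S gd ->
  S ((ga * gb) ^+ 8) -> iter 3 center_mod S = setT.
Proof.
move=> nS Sd S8; rewrite /=.
have nZ := center_mod_normal nS; have nZZ := center_mod_normal nZ.
have nZZZ := center_mod_normal nZZ.
have Zd : center_mod S gd by apply: sub_center_mod.
have ZZd : center_mod (center_mod S) gd by exact: (sub_center_mod nZ).
(* The exponent is halved at each center: [(ab)^4], then [(ab)^2 = [a, b]]. *)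
have Z4 := @center_mod_ab S 4 nS Sd S8.
have := @center_mod_ab _ 2 nZ Zd Z4.
have <- : [~ ga, gb] = (ga * gb) ^+ 2 by rewrite /commg /conjg gaV gbV expg2 !mulgA.
move=> ZZ2.
have ZZc x :
    center_mod (center_mod S) [~ x, gb] -> center_mod (center_mod S) [~ x, gc].
  move=> Zx; rewrite -gbd; apply: (nsub_commMr nZZ) => //.
  by apply: (nsub_commr nZZ).
have Zb : center_mod (center_mod (center_mod S)) gb.
  apply: (center_mod_gen nZZ) => //; first exact: (nsub_commC nZZ).
    by rewrite commgg; apply: (nsub1 nZZ).
  by apply: ZZc; rewrite commgg; apply: (nsub1 nZZ).
apply: nsub_gen => //.
- apply: (center_mod_gen nZZ) => //; last exact: ZZc.
  by rewrite commgg; apply: (nsub1 nZZ).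
- by rewrite -gbd; apply: (nsubM nZZZ) => //; apply: (sub_center_mod nZZ).
Qed.

(** Modulo [B], [ac = (ad)b] agrees with [ad], whose fourth power is trivial. *)
Lemma b_closure_ac4 : b_closure ((ga * gc) ^+ 4).
Proof.
have nB := normal_b_closure.
have expM x s n :
    b_closure s -> exists2 t, b_closure t & (x * s) ^+ n = x ^+ n * t.
  move=> Bs; elim: n => [|n [t Bt IH]].
    by exists 1; [apply: (nsub1 nB)|rewrite !expg0 mulg1].
  exists (s ^ (x ^+ n) * t).
    by apply: (nsubM nB) => //; apply: (nsubJ nB).
  by rewrite !expgS IH /conjg !mulgA mulgK.
have [t Bt] := expM (ga * gd) gb 4 b_closure_b.
rewrite -mulgA gdb => ->; suff -> : (ga * gd) ^+ 4 = 1 by rewrite mul1g.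
by rewrite -gad4 -!expg2 -expgnA.
Qed.

(** * Normal subgroups containing an active element *)

(* Some element of [N] swaps the two subtrees of the root. *)
Definition active N := exists2 h, N h & exists h0 h1, level1 (h * ga) h0 h1.

Lemma active_center_mod N x : is_normal_subgroup N -> active N ->
    (forall P, is_normal_subgroup P -> N `<=` P -> P x -> P = setT) ->
  center_mod N = setT.
Proof.
move=> nN [h Nh [h0 [h1 lh]]] gen.
have nB := normal_b_closure.
pose L := rist N; have nL : is_normal_subgroup L by apply: rist_normal.
(* As [h] swaps the subtrees, [[g, h]] has right section [g1^-1 * g0 ^ h0], and it lies in [N];
   commute [(1, f)] with it. *)
have Lh g g0 g1 f : level1 g g0 g1 -> b_closure f -> L [~ f, g1^-1 * g0 ^ h0].
  move=> lg Bf; split; first exact: (nsub_comml nB).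
  have [p lp] := b_closure_lift Bf; exists [~ p, [~ g, h]].
    by apply: nsub_commr => //; apply: nsub_commr.
  rewrite -(comm1g (g0^-1 * g1 ^ h1)); apply: level1R => //.
  apply: level1M; first exact: level1V.
  have -> : g ^ h = (g ^ (h * ga)) ^ ga by rewrite -conjgM -mulgA gaa mulg1.
  by apply: level1Ja; apply: level1J.
(* Take [g = (1, f'^-1)] in [Lh]. *)
have LB f f' : b_closure f -> b_closure f' -> L [~ f, f'].
  move=> Bf Bf'; have [p lp] := b_closure_lift (nsubV nB Bf').
  by have := Lh _ _ _ _ lp Bf; rewrite invgK conj1g mulg1.
(* The centralizer of [B] modulo [L]. *)
pose C : set Grig := [set g | forall f, b_closure f -> L [~ f, g]].
have nC : is_normal_subgroup C.
  split; first split=> [f Bf|y z Cy Cz f Bf|y Cy f Bf].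
  - by rewrite commg1; apply: (nsub1 nL).
  - by apply: (nsub_commMr nL); [apply: Cy|apply: Cz].
  - by apply: (nsub_commVr nL); apply: Cy.
  - move=> y s Cy f Bf; rewrite -(conjgKV s f) -conjRg.
    by apply: (nsubJ nL); apply: Cy; apply: (nsubJ nB).
have Cb : C gb by move=> f Bf; apply: LB => //; apply: b_closure_b.
have Ch : C (gc * ga ^ h0) by move=> f Bf; rewrite -gcV; apply: Lh level1_b Bf.
(* Modulo [C], [b] is trivial and [c] is a conjugate of [a], so [a] normally generates a quotient of
   class at most 2, which is therefore abelian. *)
have ZC : center_mod C = setT.
  apply: (@cyclic_mod_center _ _ ga) => //; last exact: b_closure_class2.
  move=> P nP CP Pa; have Pc : P gc.
    by have /(nsubMr nP) := CP _ Ch; apply; apply: (nsubJ nP).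
  by apply: nsub_gen => //; apply: CP.
have Cca : C (gc * ga).
  have : center_mod C ga by rewrite ZC.
  move=> /(_ h0) Ca; apply/(nsubMr nC _ Ca).
  by rewrite -mulgA mulVKg.
(* [B / L] is abelian and generated by conjugates of the involution [b]. *)
have Lsq f : b_closure f -> L (f * f).
  move=> Bf; suff [] : b_closure f /\ L (f * f) by [].
  apply: (@b_closure_sub [set f | b_closure f /\ L (f * f)]) f Bf => /=; last first.
    by split; [apply: b_closure_b|rewrite gbb; apply: (nsub1 nL)].
  split; first split=> /= [|y z [By Ly] [Bz Lz]|y [By Ly]].
  - by split; rewrite ?mulg1; [apply: (nsub1 nB)|apply: (nsub1 nL)].
  - split; first exact: (nsubM nB).
    rewrite (_ : _ * _ = y * y * (z * z * [~ z, y] ^ z)).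
      by do 2!apply: (nsubM nL) => //; apply: (nsubJ nL); apply: LB.
    by rewrite /commg /conjg !gnorm.
  - by split; [apply: (nsubV nB)|rewrite -invgM; apply: (nsubV nL)].
  - move=> y s [By Ly] /=.
    by split; [apply: (nsubJ nB)|rewrite -conjMg; apply: (nsubJ nL)].
have nZL := center_mod_normal nL.
(* Elements of [B] commute with [b] and [ca] modulo [L], so only [a] remains to be checked. *)
have a_center S w : is_normal_subgroup S -> L `<=` S -> b_closure w ->
    S [~ w, ga] ->
    center_mod S w.
  move=> nS LS Bw Sa; apply: center_mod_gen => //.
    by apply/LS/LB => //; apply: b_closure_b.
  rewrite -[gc]mulg1 -gaa mulgA.
  by apply: nsub_commMr => //; apply/LS/Cca.
have ZZL f : b_closure f -> center_mod (center_mod L) f.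
  move=> Bf; apply: (a_center _ _ nZL) => //; first exact: (sub_center_mod nL).
  apply: (a_center _ _ nL) => //; first exact: (nsub_comml nB).
  (* Since [a] is an involution, this double commutator is a square in [B], hence in [L]. *)
  have -> : [~ [~ f, ga], ga] = (f^-1 ^ ga * f) * (f^-1 ^ ga * f).
    by rewrite /commg /conjg !invgM !invgK gaV !mulgA -(mulgA _ ga ga) gaa mulg1.
  apply: Lsq; apply: (nsubM nB) => //.
  by do 2![apply: (nsubJ nB)|apply: (nsubV nB)].
pose Z2 := iter 2 center_mod N; have nZ2 : is_normal_subgroup Z2.
  exact: iter_center_mod_normal.
pose Z4 := iter 2 center_mod Z2; have nZ4 : is_normal_subgroup Z4.
  exact: iter_center_mod_normal.
have nL2 := rist_normal nZ2.
have L2 f : b_closure f -> center_mod L f -> rist Z2 f.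
  by move=> Bf Zf; apply: rist_center_mod => //; apply: Lsq.
(* Two passes of [rist_center_mod]: commutators of [f] are central modulo [L], so they lie in
   [rist Z2] by [L2]; thus [f] is central modulo [rist Z2]. *)
have L4 f : b_closure f -> rist Z4 f.
  move=> Bf; apply: rist_center_mod => //.
    by apply: rist_sub (Lsq _ Bf); apply: sub_iter_center_mod.
  by move=> y; apply: L2; [apply: (nsub_comml nB)|apply: ZZL].
(* The class is at most [7 = 2 + 2 + 3]: two steps to [Z2], two to [Z4], three for the dihedral
   quotient. *)
apply: (@cyclic_mod_iter_center _ _ x 6) => //.
apply: (@dihedral_class3 Z4) => //.
  exact: ristP b_closure_b level1_d (L4 _ b_closure_b).
have Bca : b_closure ((gc * ga) ^+ 4).
  by have := nsubV nB b_closure_ac4; rewrite -expVgn invgM gaV gcV.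
have [p lp] := b_closure_lift b_closure_ac4; have [q lq] := b_closure_lift Bca.
have lab : level1 ((ga * gb) ^+ 2) (gc * ga) (ga * gc).
  have := level1M (level1Ja level1_b) level1_b.
  by rewrite /conjg gaV expg2 !mulgA.
have lX g g0 g1 n : level1 g g0 g1 -> level1 (g ^+ n) (g0 ^+ n) (g1 ^+ n).
  by move=> lg; elim: n => [|n IH]; rewrite ?expg0 // !expgS; apply: level1M.
(* Both sides are [((ca)^4, (ac)^4)], because [(ab)^2 = (ca, ac)]. *)
have -> : (ga * gb) ^+ 8 = q ^ ga * p.
  rewrite -[8]/(2 * 4)%N expgnA; apply: level1_inj (lX _ _ _ 4 lab) _.
  by have := level1M (level1Ja lq) lp; rewrite mulg1 mul1g.
apply: (nsubM nZ4); last exact: ristP b_closure_ac4 lp (L4 _ b_closure_ac4).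
by apply: (nsubJ nZ4); apply: ristP Bca lq (L4 _ Bca).
Qed.

End Grigorchuk.

(** * Activities as coordinates on the abelianization *)

(* The parity of the number of vertices of depth [k] whose two children are
   swapped by [t]. *)
Fixpoint activity k (t : seq bool -> seq bool) : bool :=
  if k is k'.+1 then
    activity k' (fun w => behead (t (false :: w)))
      (+) activity k' (fun w => behead (t (true :: w)))
  else head false (t [:: false]).

Definition bool_morph (G : groupType) (chi : G -> bool) : Prop :=
  {morph chi : x y / x * y >-> x (+) y}.

Section Activity.
Implicit Types (g h x y : Grig) (N : set Grig).

Lemma activityS k g g0 g1 : level1 g g0 g1 ->
  activity k.+1 (val g) = activity k (val g0) (+) activity k (val g1).
Proof.
move=> lg /=; congr (activity _ _ (+) activity _ _); apply: funext => w.
  by rewrite (lg w).1.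
by rewrite (lg w).2.
Qed.

Lemma activitySa k g g0 g1 : level1 (g * ga) g0 g1 ->
  activity k.+1 (val g) = activity k (val g0) (+) activity k (val g1).
Proof.
move=> lg /=; rewrite addbC.
congr (activity _ _ (+) activity _ _); apply: funext => w.
  by have /= -> := (lg w).1.
by have /= -> := (lg w).2.
Qed.

Lemma activity0 g g0 g1 : level1 g g0 g1 -> activity 0 (val g) = false.
Proof. by move=> lg /=; rewrite (lg [::]).1. Qed.

Lemma activity0a g g0 g1 : level1 (g * ga) g0 g1 -> activity 0 (val g) = true.
Proof. by move=> lg /=; have /= -> := (lg [::]).2. Qed.

Lemma level1Mal g h g0 g1 h0 h1 : level1 (g * ga) g0 g1 -> level1 h h0 h1 ->
  level1 (g * h * ga) (g0 * h1) (g1 * h0).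
Proof.
move=> lg lh; rewrite (_ : _ * ga = g * ga * h ^ ga).
  by apply: level1M => //; apply: level1Ja.
by rewrite /conjg gaV !mulgA -(mulgA g ga ga) gaa mulg1.
Qed.

Lemma level1Maa g h g0 g1 h0 h1 : level1 (g * ga) g0 g1 ->
  level1 (h * ga) h0 h1 -> level1 (g * h) (g0 * h1) (g1 * h0).
Proof.
move=> lg lh; have := level1Mal lg lh.
by rewrite -!mulgA gaa mulg1.
Qed.

(** The sections of a product are products of sections, possibly paired crosswise, and the sum over
    both subtrees ignores the pairing. *)
Lemma activity_morph k : bool_morph (fun g : Grig => activity k (val g)).
Proof.
elim: k => [|k IH] g h;
  have [g0 [g1 lg]] := level1_dec g; have [h0 [h1 lh]] := level1_dec h;
  case: lg => lg; case: lh => lh.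
- by rewrite (activity0 (level1M lg lh)) (activity0 lg) (activity0 lh).
- have := level1M lg lh; rewrite mulgA => l.
  by rewrite (activity0a l) (activity0 lg) (activity0a lh).
- by rewrite (activity0a (level1Mal lg lh)) (activity0a lg) (activity0 lh).
- by rewrite (activity0 (level1Maa lg lh)) (activity0a lg) (activity0a lh).
- rewrite (activityS _ (level1M lg lh)) (activityS _ lg) (activityS _ lh).
  by rewrite !IH addbACA.
- have := level1M lg lh; rewrite mulgA => l.
  by rewrite (activitySa _ l) (activityS _ lg) (activitySa _ lh) !IH addbACA.
- rewrite (activitySa _ (level1Mal lg lh)) (activitySa _ lg) (activityS _ lh).
  rewrite !IH addbACA; congr (_ (+) _); exact: addbC.
- rewrite (activityS _ (level1Maa lg lh)) (activitySa _ lg) (activitySa _ lh).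
  rewrite !IH addbACA; congr (_ (+) _); exact: addbC.
Qed.

Lemma active_activity N g : N g -> activity 0 (val g) = true -> active N.
Proof.
move=> Ng ag; exists g => //; have [g0 [g1 [lg|lg]]] := level1_dec g.
  by rewrite (activity0 lg) in ag.
by exists g0, g1.
Qed.

(** Activities 0, 1, 2 are dual to [a], [c], [d], so this represents [g] modulo commutators. *)
Definition act_repr g : Grig :=
  ga ^+ activity 0 (val g) * (gc ^+ activity 1 (val g) *
    gd ^+ activity 2 (val g)).

Lemma act_repr_mod N g : is_normal_subgroup N -> center_mod N = setT ->
  N ((act_repr g)^-1 * g).
Proof.
move=> nN ZN; pose H h := N ((act_repr h)^-1 * h).
have ZE h k : N [~ h, k] by have : center_mod N h by rewrite ZN.
(* Induction runs over the subgroup of those [s] whose right multiplication preserves [H] both ways;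
   for an involution one direction suffices. *)
have step s : s * s = 1 ->
    (forall h, N ((act_repr (h * s))^-1 * act_repr h * s)) ->
    [set s | forall h, H h <-> H (h * s)] s.
  move=> ss rs; have st h : H h -> H (h * s).
    move=> Hh; rewrite /H.
    rewrite (_ : _^-1 * (h * s) = ((act_repr (h * s))^-1 * act_repr h * s)
                  * ((act_repr h)^-1 * h) ^ s).
      by apply: (nsubM nN) => //; apply: (nsubJ nN).
    by rewrite /conjg !gnorm.
  by move=> h; split=> [|/st]; [apply: st|rewrite -mulgA ss mulg1].
have N1 z : z = 1 -> N z by move=> ->; apply: (nsub1 nN).
have Hc : [set s | forall h, H h <-> H (h * s)] gc.
  apply: step gcc _ => h; rewrite /act_repr !activity_morph.
  rewrite [activity 0 (val gc)]/= [activity 1 (val gc)]/= [activity 2 (val gc)]/=.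
  rewrite !addbF addbT; apply: N1.
  rewrite !invgM !mulgA mulgVK; case: (activity 1 _); case: (activity 2 _);
    rewrite /= ?expg0 ?expg1 ?invg1 ?gcV ?gdV ?mul1g ?mulg1 ?gcc //;
    by rewrite gdc gbd gcc.
have Hd : [set s | forall h, H h <-> H (h * s)] gd.
  apply: step gdd _ => h; rewrite /act_repr !activity_morph.
  rewrite [activity 0 (val gd)]/= [activity 1 (val gd)]/= [activity 2 (val gd)]/=.
  rewrite !addbF addbT; apply: N1.
  rewrite !invgM !mulgA mulgVK mulgVK; case: (activity 2 _);
    by rewrite /= ?expg0 ?expg1 ?invg1 ?gdV ?mul1g ?mulg1 ?gdd.
have Ha : [set s | forall h, H h <-> H (h * s)] ga.
  apply: step gaa _ => h; rewrite /act_repr !activity_morph.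
  rewrite [activity 0 (val ga)]/= [activity 1 (val ga)]/= [activity 2 (val ga)]/=.
  rewrite !addbF addbT; set v := _ * _ ^+ activity 2 _.
  have Nv z : z = [~ v, ga] -> N z by move=> ->.
  apply: Nv; rewrite /commg /conjg gaV !invgM !mulgA.
  by case: (activity 0 _); rewrite /= ?expg0 ?expg1 ?invg1 ?gaV ?mul1g ?mulg1.
have sH : is_subgroup [set s | forall h, H h <-> H (h * s)].
  split=> /= [h|s t Hs Ht h|s Hs h]; first by rewrite mulg1.
    by rewrite mulgA -Ht.
  by rewrite (Hs (h * _)) mulgVK.
have : [set s | forall h, H h <-> H (h * s)] g.
  by rewrite (grig_ind_gen sH) // -gcd; case: sH => _ + _; apply.
move=> /(_ 1); rewrite mul1g => -[+ _]; apply.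
rewrite /H /act_repr /= !expg0 !mulg1 invg1; exact: (nsub1 nN).
Qed.

Lemma same_activity_mod N g h : is_normal_subgroup N -> center_mod N = setT ->
  (forall k, k < 3 -> activity k (val g) = activity k (val h)) -> N (g^-1 * h).
Proof.
move=> nN ZN gh; have Ng := act_repr_mod g nN ZN; have := act_repr_mod h nN ZN.
rewrite /act_repr -!gh // => Nh.
have := nsubM nN (nsubV nN Ng) Nh.
by rewrite invgM invgK -mulgA /act_repr mulVKg.
Qed.

End Activity.

(** * Sequences of AC-moves *)

Section ACEquivalence.
Variables (G : groupType) (n : nat).
Implicit Types (x y z : {ffun 'I_n -> G}) (chi psi : G -> bool).

(** Defined on all tuples, not only vertices; [ac_equiv_gen] recovers normal generation along the
    way. *)
Inductive ac_equiv x : {ffun 'I_n -> G} -> Prop :=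
| ac_refl : ac_equiv x x
| ac_step y z of ac_equiv x y & ac_move y z : ac_equiv x z.

Lemma replace_entryE x i g : replace_entry x i g i = g.
Proof. by rewrite ffunE eqxx. Qed.

Lemma replace_entryN x i g j : j != i -> replace_entry x i g j = x j.
Proof. by rewrite ffunE => /negbTE ->. Qed.

Lemma replace_entryK x i g h :
  replace_entry (replace_entry x i g) i h = replace_entry x i h.
Proof. by apply/ffunP=> j; rewrite !ffunE; case: eqP. Qed.

Lemma replace_entry_id x i : replace_entry x i (x i) = x.
Proof. by apply/ffunP=> j; rewrite ffunE; case: eqP => // ->. Qed.

Lemma ac_move_sym x y : ac_move x y -> ac_move y x.
Proof.
have back i g h m :
    ac_move (replace_entry x i g) (replace_entry (replace_entry x i g) i h) ->
    h = x i -> m = replace_entry x i g -> ac_move m x.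
  by move=> + hx -> ; rewrite replace_entryK hx replace_entry_id.
case=> [i j|i j|i j|i j|j|i s] => [ji|ji|ji|ji||].
- apply: (back _ _ _ _ (ACdivr _ ji)) => //.
  by rewrite replace_entryE replace_entryN // mulgK.
- apply: (back _ _ _ _ (ACmulr _ ji)) => //.
  by rewrite replace_entryE replace_entryN // mulgVK.
- apply: (back _ _ _ _ (ACdivl _ ji)) => //.
  by rewrite replace_entryE replace_entryN // mulKg.
- apply: (back _ _ _ _ (ACmull _ ji)) => //.
  by rewrite replace_entryE replace_entryN // mulVKg.
- apply: (back _ _ _ _ (ACinv _ j)) => //.
  by rewrite replace_entryE invgK.
- apply: (back _ _ _ _ (ACconj _ i s^-1)) => //.
  by rewrite replace_entryE conjgK.
Qed.

Lemma ac_move1 x y : ac_move x y -> ac_equiv x y.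
Proof. by apply: ac_step; apply: ac_refl. Qed.

Lemma ac_trans x y z : ac_equiv x y -> ac_equiv y z -> ac_equiv x z.
Proof. by move=> xy; elim=> // u v _ xu uv; apply: ac_step uv. Qed.

Lemma ac_sym x y : ac_equiv x y -> ac_equiv y x.
Proof.
elim=> [|u v _ ux uv]; first exact: ac_refl.
by apply: ac_trans ux; apply/ac_move1/ac_move_sym.
Qed.

Lemma normally_generatingP x : normally_generating x <->
  forall P, is_normal_subgroup P -> (forall i, P (x i)) -> P = setT.
Proof.
split=> [gx P nP Px|gx].
  apply/seteqP; split=> // g _; have : [set: G] g by [].
  by rewrite -gx; apply: smallest_sub => // _ [i _ <-].
apply: gx => [|i]; first exact: normal_closure_normal.
by apply: sub_gen_smallest; exists i.
Qed.

Lemma ac_move_gen x y : ac_move x y -> normally_generating x ->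
  normally_generating y.
Proof.
move=> /ac_move_sym yx /normally_generatingP gx.
apply/normally_generatingP => P nP Py; apply: gx => // k.
case: yx => [i j|i j|i j|i j|j|i s] => [ji|ji|ji|ji||];
  rewrite ffunE; case: eqP => _ //.
- exact: (nsubM nP).
- by apply: (nsubM nP) => //; apply: (nsubV nP).
- exact: (nsubM nP).
- by apply: (nsubM nP) => //; apply: (nsubV nP).
- exact: (nsubV nP).
- exact: (nsubJ nP).
Qed.

Lemma ac_equiv_gen x y : ac_equiv x y -> normally_generating x ->
  normally_generating y.
Proof. by move=> xy gx; elim: xy => // u v _ gu /ac_move_gen; apply. Qed.

Lemma ac_equiv_path (u v : ac_vertex G n) : ac_equiv (val u) (val v) ->
  exists p, path (@ac_edge G n) u p /\ last u p = v.
Proof.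
move yE: (val v) => y uy; elim: uy v yE => [|y' z uy IH yz] v vz.
  by exists [::]; split=> //; apply: val_inj.
have gy : `[< normally_generating y' >].
  by apply/asboolP; apply: ac_equiv_gen uy _; apply/asboolP; apply: (valP u).
have [p [up lp]] := IH (exist _ y' gy) erefl.
exists (rcons p v); rewrite rcons_path last_rcons up lp; split=> //=.
by apply/asboolP; left; rewrite vz.
Qed.

(* The set of elements by which the entry [i] can be multiplied, whatever this
   entry is, is a normal subgroup: to multiply by [m ^ s], conjugate the entry
   by [s^-1], multiply by [m] and conjugate back. *)
Lemma ac_mul_closure x i m :
    normal_closure [set x j | j in [set j | j != i]] m ->
  ac_equiv x (replace_entry x i (x i * m)).
Proof.
(* Entry [i] of [y] is left free because it changes between successive multiplications. *)
pose Q : set G := [set m | forall y, (forall j, j != i -> y j = x j) ->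
  ac_equiv y (replace_entry y i (y i * m))].
suff nQ : is_normal_subgroup Q.
  move=> xm; suff Qm : Q m by apply: Qm.
  move: m xm; apply: smallest_sub => // _ [j /= ji <-] y yx.
  by rewrite -yx //; apply/ac_move1/ACmulr.
have eq_off y g : (forall j, j != i -> y j = x j) ->
    forall j, j != i -> replace_entry y i g j = x j.
  by move=> yx j ji; rewrite replace_entryN // yx.
split; first split=> [y _|g h Qg Qh y yx|g Qg y yx].
- by rewrite mulg1 replace_entry_id; apply: ac_refl.
- apply: ac_trans (Qg y yx) _; have := Qh _ (eq_off _ (y i * g) yx).
  by rewrite replace_entryE replace_entryK mulgA.
- apply: ac_sym; have := Qg _ (eq_off _ (y i * g^-1) yx).
  by rewrite replace_entryE replace_entryK mulgVK replace_entry_id.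
- move=> g s Qg y yx; apply: ac_trans (ac_move1 (ACconj y i s^-1)) _.
  apply: ac_trans (Qg _ (eq_off _ _ yx)) _.
  rewrite replace_entryE replace_entryK.
  have := ac_move1 (ACconj (replace_entry y i (y i ^ s^-1 * g)) i s).
  by rewrite replace_entryE replace_entryK conjMg conjgKV.
Qed.

(** Entries are replaced one at a time, so each intermediate tuple mixes entries of [x] and [z]. *)
Lemma ac_replace_all x z :
    (forall y i, ac_equiv x y -> (forall j, y j = x j \/ y j = z j) ->
      ac_equiv y (replace_entry y i (z i))) ->
  ac_equiv x z.
Proof.
move=> xz.
have [y [xy yz]] : exists y, ac_equiv x y /\
    forall j, y j = if j \in enum 'I_n then z j else x j.
  elim: (enum 'I_n) => [|i s [y [xy ys]]].
    by exists x; split=> //; apply: ac_refl.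
  exists (replace_entry y i (z i)); split=> [|j].
    apply: ac_trans xy (xz _ _ xy _) => j; rewrite ys.
    by case: ifP; [right|left].
  by rewrite ffunE inE ys; case: eqP => [->|].
suff <- : y = z by [].
by apply/ffunP=> j; rewrite yz mem_enum.
Qed.

Lemma bool_morph_normal chi :
  bool_morph chi -> is_normal_subgroup [set g | chi g = false].
Proof.
move=> cM; have c1 : chi 1 = false by have := cM 1 1; rewrite mulg1; case: (chi 1).
have cV g : chi g^-1 = chi g.
  by have := cM g g^-1; rewrite mulgV c1; case: (chi g); case: (chi _).
split; first split=> //= [g h gF hF|g gF].
- by rewrite cM gF hF.
- by rewrite cV.
- by move=> g s /=; rewrite /conjg !cM cV => ->; rewrite /= addbb.
Qed.

(** Otherwise the kernel of [chi] is a proper normal subgroup containing all entries. *)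
Lemma generating_morph x chi g : normally_generating x -> bool_morph chi ->
  chi g = true -> exists k, chi (x k) = true.
Proof.
move=> /normally_generatingP gx cM cg; apply: contrapT => nx.
have /seteqP[_ /(_ g I)] : [set g | chi g = false] = setT.
  apply: gx (bool_morph_normal cM) _ => i /=.
  by apply/negbTE/negP => xi; apply: nx; exists i.
by rewrite /= cg.
Qed.

(** One pivot step of Gaussian elimination over the field with two elements. The last clause keeps
    the columns already cleared. *)
Lemma ac_eliminate psi x i k : bool_morph psi -> psi (x k) = true ->
  exists y, [/\ ac_equiv x y, (forall j, psi (y j) = (j == i))
   & forall chi, bool_morph chi -> chi (x k) = false -> chi (x i) = false ->
     forall j, chi (y j) = chi (x j)].
Proof.
move=> pM pk.
have [x' [xx' px' cx']] : exists x', [/\ ac_equiv x x', psi (x' i) = true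
   & forall chi, bool_morph chi -> chi (x k) = false -> chi (x i) = false ->
     forall j, chi (x' j) = chi (x j)].
  have [pi|pi] := boolP (psi (x i)); first by exists x; split=> //; apply: ac_refl.
  have ki : k != i by apply: contraNneq pi => <-.
  exists (replace_entry x i (x i * x k)); split.
  - exact/ac_move1/ACmulr.
  - by rewrite replace_entryE pM pk (negbTE pi).
  - by move=> chi cM ck ci j; rewrite ffunE; case: eqP => // ->; rewrite cM ck ci.
pose z := [ffun j => if (j != i) && psi (x' j) then x' j * x' i else x' j].
exists z; split.
- apply: ac_trans xx' _; apply: ac_replace_all => y j _ yz.
  have zi : z i = x' i by rewrite ffunE eqxx.
  have yi : y i = x' i by case: (yz i); rewrite ?zi.
  have [<-|yj] : y j = z j \/ y j = x' j by case: (yz j); [right|left].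
    by rewrite replace_entry_id; apply: ac_refl.
  rewrite ffunE; case: ifP => [/andP[ji _]|_]; rewrite -yj.
    by rewrite -yi; apply/ac_move1/ACmulr; rewrite eq_sym.
  by rewrite replace_entry_id; apply: ac_refl.
- move=> j; rewrite ffunE; have [->|/=] := eqVneq j i; first by rewrite px'.
  by case: (boolP (psi (x' j))) => [pj|/negbTE//]; rewrite pM pj px'.
- move=> chi cM ck ci j; rewrite -cx' // ffunE; case: ifP => // _.
  by rewrite cM (cx' chi cM ck ci i) ci addbF.
Qed.

End ACEquivalence.

(** * Reduction to a fixed tuple *)

(* For [k < 3], the coordinates on the abelianization [(Z/2)^3] dual to the
   basis [a, ac, ad]; junk for [k >= 3]. *)
Definition dual_coord k (g : grigorchuk) : bool :=
  if k is 0 then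
    activity 0 (val g) (+) (activity 1 (val g) (+) activity 2 (val g))
  else activity k (val g).

Lemma dual_coord_morph k : bool_morph (dual_coord k).
Proof.
case: k => [|k] g h /=; last exact: (activity_morph k.+1).
have /= -> := activity_morph 0 g h; have /= -> := activity_morph 1 g h.
have /= -> := activity_morph 2 g h.
by rewrite (addbACA (activity 1 _)) addbACA.
Qed.

Lemma bool_morphD (G : groupType) (e : bool) (phi psi : G -> bool) :
  bool_morph phi -> bool_morph psi ->
  bool_morph (fun g => phi g (+) (e && psi g)).
Proof.
move=> fM pM g h /=; rewrite fM pM.
by case: e => /=; rewrite ?addbF // addbACA.
Qed.

(* Unlike with [a, c, d], removing any single entry leaves an element swapping
   the two subtrees of the root. *)
Definition active_basis (m : nat) (j : 'I_m.+3) : grigorchuk :=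
  match val j with 0 => ga | 1 => ga * gc | 2 => ga * gd | _ => 1 end.

Lemma dual_coord_active_basis m k (j : 'I_m.+3) : k < 3 ->
  dual_coord k (active_basis j) = (val j == k).
Proof.
by case: j => -[|[|[|j]]] jm; case: k => [|[|[|k]]] // _.
Qed.

Section Reduction.
Variable m : nat.
Implicit Types x y : {ffun 'I_m.+3 -> grigorchuk}.

Let i0 : 'I_m.+3 := Ordinal (isT : 0 < m.+3).
Let i1 : 'I_m.+3 := Ordinal (isT : 1 < m.+3).
Let i2 : 'I_m.+3 := Ordinal (isT : 2 < m.+3).

Lemma active_basis_gen : normally_generating [ffun j : 'I_m.+3 => active_basis j].
Proof.
apply/normally_generatingP => P nP Pb.
have Pa : P ga by have := Pb i0; rewrite ffunE.
have Pc : P gc by have := Pb i1; rewrite ffunE => /(nsubMl nP _ Pa).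
have Pd : P gd by have := Pb i2; rewrite ffunE => /(nsubMl nP _ Pa).
by apply: nsub_gen => //; rewrite -gcd; apply: (nsubM nP).
Qed.

Lemma ac_reduce_abelianization x : normally_generating x ->
  exists2 y, ac_equiv x y & forall k j, k < 3 -> dual_coord k (y j) = (val j == k).
Proof.
move=> gx; have pM := dual_coord_morph.
have [k0 k0P] : exists k, dual_coord 0 (x k) = true.
  by apply: (generating_morph (g := ga)).
have [y0 [xy0 y00 _]] := ac_eliminate i0 (pM 0) k0P.
have gy0 := ac_equiv_gen xy0 gx.
(* The multiple of coordinate 0 makes the sum vanish on entry [i0], so the new pivot lies elsewhere.
   The third pivot is found likewise. *)
have [|k1] := generating_morph (g := ga * gc) gy0
  (bool_morphD (dual_coord 1 (y0 i0)) (pM 1%N) (pM 0)).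
  by rewrite [dual_coord 0 _]/= andbF.
rewrite [dual_coord 0 _]y00; have [->|k10 k1P] := eqVneq k1 i0.
  by rewrite andbT addbb.
rewrite andbF addbF in k1P.
have [y1 [xy1 y11 cy1]] := ac_eliminate i1 (pM 1%N) k1P.
have y10 j : dual_coord 0 (y1 j) = (j == i0).
  by rewrite cy1 // ?y00 //; apply/negbTE.
have gy1 := ac_equiv_gen xy1 gy0.
have [|k2] := generating_morph (g := ga * gd) gy1
  (bool_morphD (dual_coord 2 (y1 i1))
    (bool_morphD (dual_coord 2 (y1 i0)) (pM 2) (pM 0)) (pM 1%N)).
  by rewrite [dual_coord 0 _]/= [dual_coord 1 (ga * _)]/= !andbF.
rewrite [dual_coord 0 _]y10 [dual_coord 1 _]y11.
have [->|k20] := eqVneq k2 i0; first by rewrite andbT andbF addbF addbb.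
have [->|k21] := eqVneq k2 i1; first by rewrite andbF andbT addbF addbb.
rewrite !andbF !addbF => k2P.
have [y2 [xy2 y22 cy2]] := ac_eliminate i2 (pM 2) k2P.
exists y2; first by apply: ac_trans xy0 _; apply: ac_trans xy1 xy2.
have y20 j : dual_coord 0 (y2 j) = (j == i0).
  by rewrite cy2 // [_ _ (_ _)]y10 //; apply/negbTE.
have y21 j : dual_coord 1 (y2 j) = (j == i1).
  by rewrite cy2 // [_ _ (_ _)]y11 //; apply/negbTE.
by case=> [|[|[|k]]] j.
Qed.

Lemma ac_reduce x : normally_generating x ->
  ac_equiv x [ffun j : 'I_m.+3 => active_basis j].
Proof.
move=> gx; have [y xy yP] := ac_reduce_abelianization gx.
have gy := ac_equiv_gen xy gx.
apply: ac_trans xy _; apply: ac_replace_all => z i yz zP.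
have gz := ac_equiv_gen yz gy.
(* Source and target entries have equal coordinates, so the mixed tuple has them too. *)
have zpsi k j : k < 3 -> dual_coord k (z j) = (val j == k).
  by move=> k3; case: (zP j) => ->; rewrite ?yP // ffunE dual_coord_active_basis.
rewrite ffunE -[active_basis i](mulVKg (z i)).
apply: ac_mul_closure; set N := normal_closure _.
have nN : is_normal_subgroup N by apply: normal_closure_normal.
have Nz j : j != i -> N (z j) by move=> ji; apply: sub_gen_smallest; exists j.
have actE (g : grigorchuk) :
    activity 0 (val g) = dual_coord 0 g (+) (dual_coord 1 g (+) dual_coord 2 g).
  by rewrite /= -addbA addbb addbF.
have ZN : center_mod N = setT.
  apply: (@active_center_mod N (z i)) => // [|P nP NP Pi]; last first.
    move/normally_generatingP: gz; apply=> // j.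
    by have [->//|/Nz/NP] := eqVneq j i.
  (* Entry [l] differs from entry [i] and has exactly one nonzero dual coordinate; their sum is
     activity 0, so this entry swaps the two subtrees. *)
  pose l := if i == i0 then i1 else i0.
  have li : l != i by rewrite /l; case: (eqVneq i i0) => [->|]; rewrite // eq_sym.
  apply: (active_activity (Nz _ li)).
  by rewrite actE !zpsi // /l; case: ifP.
apply: same_activity_mod => // k k3.
have e k' : k' < 3 -> dual_coord k' (z i) = dual_coord k' (active_basis i).
  by move=> k'3; rewrite zpsi // dual_coord_active_basis.
case: k k3 => [_|k k3]; last exact: (e k.+1).
by rewrite !actE !e.
Qed.

End Reduction.

Theorem corollary1p3 (n : nat) (hn : 3 <= n) :
  connected_graph (@ac_edge grigorchuk n).
Proof.
case: n hn => [|[|[|m]]] // _.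
split=> [|u v].
  constructor; exists [ffun j : 'I_m.+3 => active_basis j].
  by apply/asboolP; apply: active_basis_gen.
have red (w : ac_vertex grigorchuk m.+3) := ac_reduce (elimT (asboolP _) (valP w)).
by apply: ac_equiv_path; apply: ac_trans (red u) (ac_sym (red v)).
Qed.
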